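(* Let $(e_n)$ be an almost greedy bounded Markushevich basis of a Banach space $X$. Let $0<\tau<1$ be a weakness parameter and let $0\le\lambda<1$ be any scalar. Then there exists a constant $C$ such that for any $x\in X$, $m\in\mathbb{N}$, any $A\subset\mathbb{N}$ with $|A\cap\Lambda_m^\tau(x)|\le\lambda m$ and $|A|\le m$, and any $a_i\in\mathbb{R}$, $i\in A$, we have $$\|x-G_m^\tau(x)\|\le C\Big\|x-\sum_{i\in A}a_ie_i\Big\|.$$
   Context: $X$ is a real Banach space (possibly finite-dimensional; if $\dim X=N<\infty$, all indices and index sets lie in $\{1,\dots,N\}$ instead of $\mathbb{N}$, and $m\le N$). $(e_n)$ with biorthogonal functionals $(e_n^* )$ is a bounded Markushevich basis if $((e_n),(e_n^* ))$ is a biorthogonal system such that $a<\|e_n\|,\|e_n^*\|<b$ for some positive constants $a,b$, the linear span of $(e_n)$ is dense in $X$, and the map $x\mapsto(e_n^*(x))$ is injective. For a finite index set $A$, $P_A(x)=\sum_{i\in A}e_i^*(x)e_i$ and $|A|$ is its cardinality. Weak thresholding greedy algorithm with weakness parameter $\tau$: $\Lambda_m^\tau(x)$ denotes any set of $m$ indices such that $\min_{n\in\Lambda_m^\tau(x)}|e_n^*(x)|\ge\tau\max_{n\notin\Lambda_m^\tau(x)}|e_n^*(x)|$, and $G_m^\tau(x)=\sum_{n\in\Lambda_m^\tau(x)}e_n^*(x)e_n$ (the assertion is for every such choice of $\Lambda_m^\tau(x)$). Almost greedy: there is a constant $C'$ such that $\|x-G_m(x)\|\le C'\inf\{\|x-P_A(x)\|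 : |A|\le m\}$ for all $x\in X$ and $m\in\mathbb{N}$, where $G_m(x)=\sum_{n\in\Lambda_m(x)}e_n^*(x)e_n$ for any set $\Lambda_m(x)$ of $m$ indices with $\min_{n\in\Lambda_m(x)}|e_n^*(x)|\ge\max_{n\notin\Lambda_m(x)}|e_n^*(x)|$. *)

(* Defs.v *)
From HB Require Import structures.
From mathcomp Require Import all_boot all_order all_algebra finmap.
From mathcomp Require Import all_classical all_reals all_analysis.

Set Implicit Arguments.
Unset Strict Implicit.
Unset Printing Implicit Defensive.

Import Order.TTheory GRing.Theory Num.Theory.
Import numFieldNormedType.Exports.

Local Open Scope classical_set_scope.
Local Open Scope ring_scope.

(* [None] is the infinite-dimensional case and [Some N] the case dim X = N;
   indices start at 0 rather than 1. *)
Definition index_type (d : option nat) : countType :=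
  if d is Some N then 'I_N : countType else nat : countType.

Definition dual_norm (R : realType) (X : normedModType R) (f : X -> R) : R :=
  sup [set `|f x| | x in [set x : X | `|x| <= 1]].

Definition lin_span (R : realType) (X : normedModType R) (I : choiceType)
    (e : I -> X) : set X :=
  [set v | exists (A : {fset I}) (c : I -> R), v = \sum_(i <- A) c i *: e i].

Definition bounded_markushevich_basis (R : realType) (X : normedModType R)
    (I : choiceType) (e : I -> X) (es : I -> {linear X -> R^o}) : Prop :=
  [/\ forall n, continuous (es n),
      forall i j, es i (e j) = (i == j)%:R,
      exists a b : R, [/\ 0 < a, 0 < b,
        forall n, a < `|e n| < b & forall n, a < dual_norm (es n) < b],
      dense (lin_span e) &
      injective (fun (x : X) (n : I) => es n x)].

Definition coord_proj (R : realType) (X : normedModType R) (I : choiceType)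
    (e : I -> X) (es : I -> {linear X -> R^o}) (A : {fset I}) (x : X) : X :=
  \sum_(i <- A) (es i x : R) *: e i.

(* [L] is a possible choice of Lambda_m^tau(x). The inequality
   min_L >= tau * max_(~ L) is unfolded elementwise, so that it holds vacuously
   when [L] contains every index. *)
Definition weak_greedy_set (R : realType) (X : normedModType R)
    (I : choiceType) (es : I -> {linear X -> R^o})
    (tau : R) (m : nat) (x : X) (L : {fset I}) : Prop :=
  #|` L| = m /\
  forall i j, i \in L -> j \notin L ->
    tau * `|es j x : R| <= `|es i x : R|.

Definition greedy_set (R : realType) (X : normedModType R)
    (I : choiceType) (es : I -> {linear X -> R^o}) :=
  weak_greedy_set es 1.

Definition almost_greedy (R : realType) (X : normedModType R)
    (I : choiceType) (e : I -> X) (es : I -> {linear X -> R^o}) : Prop :=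
  exists C : R, forall (x : X) (m : nat) (L : {fset I}),
    (0 < m)%N -> greedy_set es m x L ->
    `|x - coord_proj e es L x| <=
      C * inf [set `|x - coord_proj e es A x| |
                 A in [set A : {fset I} | (#|` A| <= m)%N]].

(* Main.v *)
(* Let t be the minimum of |e_i^*(x)| on L and z = x - sum_A a_i e_i. Off L the
   coefficients of x are at most t/tau, so the coefficients of z exceeding t/tau
   form a finite greedy set G inside A u L, and
     x - P_L x = (z - P_G z) - P_((A u L) \ G) z + P_(A \ L) x.
   The first term is controlled by quasi-greediness. The other two are sums of at
   most 2m terms with coefficients at most t/tau, whereas z has at least
   (1 - lambda) m coefficients that are at least t, namely those on L \ A. Hence
   everything rests on the estimate |sum_F c_i e_i| <= K |x| whenever |c_i| <= t
   on F and x has at least |F| coefficients of modulus at least t: truncating x at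
   height t (Abel summation over greedy sets) reduces it to democracy for
   arbitrary coefficients in [-t, t], which almost greediness gives. *)
Require Import Defs.
From mathcomp Require Import all_boot all_order all_algebra finmap.
From mathcomp Require Import all_classical all_reals all_analysis.
From mathcomp Require Import lra zify.

Import Order.TTheory GRing.Theory Num.Theory.
Import numFieldNormedType.Exports.

Local Open Scope ring_scope.

(** * Finite index sets and Abel summation *)

Lemma exists_fset_min {R : realDomainType} {I : choiceType} (G : {fset I})
    (f : I -> R) :
  G != fset0 -> exists2 i, i \in G & forall j, j \in G -> f i <= f j.
Proof.
case/fset0Pn => i0 i0G.
case: (@arg_minP _ _ G [` i0G]%fset predT (f \o val) isT) => i _ imin.
exists (val i) => [|j jG]; first exact: valP.
exact: (imin [` jG]%fset isT).
Qed.

Lemma exists_fsubset_card {I : choiceType} (F : {fset I}) (k : nat) :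
  (k <= #|` F|)%N -> exists2 T : {fset I}, (T `<=` F)%fset & #|` T| = k.
Proof.
move=> kF; exists [fset i in take k (enum_fset F)]%fset.
  by apply/fsubsetP => i; rewrite !inE => /mem_take.
rewrite card_fseq undup_id ?take_uniq ?fset_uniq // size_take.
by case: ltngtP kF => // ->.
Qed.

Lemma big_fsetIDset {V : nmodType} {I : choiceType} (A B : {fset I})
    (F : I -> V) :
  \sum_(i <- A) F i =
  \sum_(i <- (A `&` B)%fset) F i + \sum_(i <- (A `\` B)%fset) F i.
Proof.
rewrite (big_fsetID _ (mem B)); congr (_ + _); apply: eq_fbigl => i.
  by rewrite !inE.
by rewrite !inE andbC.
Qed.

(* Abel summation: peeling off the smallest weight leaves weights of the same
   kind on one index less, so only the sums over upper sets of [v] matter. *)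
Lemma norm_weighted_sum_le {R : realType} {V : normedModType R} {I : choiceType}
    (G : {fset I}) (y : I -> V) (v : I -> R) (M N : R) :
  0 <= M -> (forall i, i \in G -> 0 <= v i <= M) ->
  (forall H : {fset I}, (H `<=` G)%fset ->
     (forall i j, i \in H -> j \in G -> j \notin H -> v j <= v i) ->
     `|\sum_(i <- H) y i| <= N) ->
  `|\sum_(i <- G) v i *: y i| <= M * N.
Proof.
move: {2}#|` G| (erefl #|` G|) => n.
elim: n G v M => [|n IH] G v M cardG M0 vM hN.
  (* The empty upper set forces [N] to be nonnegative. *)
  have N0 : 0 <= N.
    by have := hN fset0 (fsub0set _) (fun i j => ltac:(done));
       rewrite big_seq_fset0 normr0.
  by rewrite (cardfs0_eq cardG) big_seq_fset0 normr0 mulr_ge0.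
have [|i0 i0G i0min] := @exists_fset_min _ _ G v.
  by rewrite -cardfs_gt0 cardG.
have /andP[v0 v0M] := vM _ i0G.
have -> : \sum_(i <- G) v i *: y i =
    v i0 *: \sum_(i <- G) y i + \sum_(i <- (G `\ i0)%fset) (v i - v i0) *: y i.
  rewrite scaler_sumr !(big_fsetD1 i0 i0G) /= -addrA -big_split /=.
  by congr (_ + _); apply: eq_bigr => i _; rewrite -scalerDl addrC subrK.
have -> : M * N = v i0 * N + (M - v i0) * N by lra.
rewrite (le_trans (ler_normD _ _)) // lerD //.
  rewrite normrZ ger0_norm // ler_wpM2l //; apply: hN => // i j _ jG.
  by rewrite jG.
apply: IH; first by move: cardG; rewrite (cardfsD1 i0) i0G => -[].
- by rewrite subr_ge0.
- move=> i; rewrite !inE => /andP[_ iG]; have /andP[_ ?] := vM _ iG.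
  by rewrite subr_ge0 i0min //= lerD2r.
(* Upper sets for the shifted weights on [G] without [i0] stay upper in [G], because [i0] carries
   the least weight. *)
- move=> H HG Hup; apply: hN => [|i j iH jG jH].
    by apply/fsubsetP => i /(fsubsetP HG); rewrite !inE => /andP[].
  have iG : i \in G by move/fsubsetP: HG => /(_ i iH); rewrite !inE => /andP[].
  have [->|ji0] := eqVneq j i0; first exact: i0min.
  by have := Hup i j iH; rewrite lerD2r; apply=> //; rewrite !inE ji0.
Qed.

(** * Coordinates in a biorthogonal system *)

Section Basis.
Context {R : realType} {X : normedModType R} {I : choiceType}.
Context {e : I -> X} {es : I -> {linear X -> R^o}}.

Lemma norm_le_dual_norm {f : {linear X -> R^o}} {x : X} :
  0 < dual_norm f -> `|f x : R| <= dual_norm f * `|x|.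
Proof.
move=> f0; have [->|x0] := eqVneq x 0; first by rewrite linear0 !normr0 mulr0.
have nx0 : 0 < `|x| by rewrite normr_gt0.
(* [sup] is 0 by default where no supremum exists, so [0 < dual_norm f] yields boundedness. *)
have hs : has_sup [set (`|f x : R|) | x in [set x : X | `|x| <= 1]]%classic.
  apply: contrapT => h; move: f0; rewrite /dual_norm.
  by rewrite (sup_out h) ltxx.
rewrite -ler_pdivrMr // -(ger0_norm (ltW nx0)) -normfV -normrM.
apply: (sup_upper_bound hs); exists (`|x|^-1 *: x) => /=.
  by rewrite normrZ normfV normr_id mulVf // gt_eqF.
by rewrite linearZ /= /GRing.scale /= mulrC.
Qed.

Hypothesis biorth : forall i j, es i (e j) = (i == j)%:R.

Lemma coord_sum (A : {fset I}) (c : I -> R) (i : I) :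
  es i (\sum_(j <- A) c j *: e j) = (if i \in A then c i else 0).
Proof.
rewrite linear_sum /=; case: ifPn => iA.
  rewrite (big_fsetD1 i iA) /= big1_fset ?addr0 => [|j].
    by rewrite linearZ /= biorth eqxx /GRing.scale /= mulr1.
  rewrite !inE => /andP[ji _] _.
  by rewrite linearZ /= biorth eq_sym (negPf ji) scaler0.
rewrite big1_fset // => j jA _; rewrite linearZ /= biorth.
by case: eqVneq => [ij|_]; rewrite ?scaler0 //; rewrite ij jA in iA.
Qed.

Lemma coord_proj_sum {T G : {fset I}} {c : I -> R} : (T `<=` G)%fset ->
  coord_proj e es T (\sum_(j <- G) c j *: e j) = \sum_(j <- T) c j *: e j.
Proof.
move=> /fsubsetP TG; apply: eq_fbigr => i iT _.
by rewrite coord_sum (TG _ iT).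
Qed.

End Basis.

(** By density some [v] in the span lies within [t / b] of [x]. Off the finite support of [v] the
    coordinates of [x] are those of [x - v], hence below [b * (t / b) = t]. *)
Lemma finite_large_coords {R : realType} {X : normedModType R} {I : choiceType}
    {e : I -> X} {es : I -> {linear X -> R^o}} {x : X} {t : R} :
  bounded_markushevich_basis e es -> 0 < t ->
  exists G : {fset I}, forall i, (i \in G) = (t <= `|es i x : R|).
Proof.
case=> _ biorth [a [b [a0 b0 _ es_ab]]] dns _ t0.
have tb0 : 0 < t / b by rewrite divr_gt0.
have [|v [/= xv [A [c ve]]]] := dns (ball x (t / b)) _ (ball_open _ _).
  by exists x; exact: ballxx.
exists [fset i in A | t <= `|es i x : R|]%fset => i; rewrite !inE /=.
have [//|iA /=] := boolP (i \in A); apply/esym/negbTE; rewrite -ltNge.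
have /andP[ai bi] := es_ab i.
have -> : es i x = es i (x - v).
  by rewrite linearB /= ve (coord_sum biorth) (negPf iA) subr0.
apply: le_lt_trans (norm_le_dual_norm (lt_trans a0 ai)) _.
move: xv; rewrite -ball_normE /= ltr_pdivlMr // => xv.
apply: le_lt_trans xv; rewrite mulrC ler_wpM2l //; exact: ltW.
Qed.

(** * Quasi-greediness, democracy and truncation from almost greediness *)

Section AlmostGreedy.
Context {R : realType} {X : normedModType R} {I : choiceType}.
Context {e : I -> X} {es : I -> {linear X -> R^o}}.

(** Raising the constant to at least 1 covers the empty greedy set, whose only competitor is empty
    too. *)
Lemma almost_greedy_const : almost_greedy e es -> exists2 C : R, 1 <= C &
  forall (x : X) (L A : {fset I}), greedy_set es #|` L| x L ->
    (#|` A| <= #|` L|)%N ->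
    `|x - coord_proj e es L x| <= C * `|x - coord_proj e es A x|.
Proof.
case=> C hC; exists (Num.max 1 C) => [|x L A grL AL].
  by rewrite le_max lexx.
have C1 : 1 <= Num.max 1 C by rewrite le_max lexx.
have [L0|L0] := posnP #|` L|.
  rewrite L0 leqn0 cardfs_eq0 in AL; rewrite (eqP AL) (cardfs0_eq L0).
  by rewrite ler_peMl.
apply: le_trans (hC x _ L L0 grL) _.
have lb : lbound [set `|x - coord_proj e es A x| |
                 A in [set A : {fset I} | (#|` A| <= #|` L|)%N]]%classic 0.
  by move=> _ [B _ <-].
apply: (@le_trans _ _ (Num.max 1 C * inf [set `|x - coord_proj e es A x| |
                 A in [set A : {fset I} | (#|` A| <= #|` L|)%N]]%classic)).
  rewrite ler_wpM2r ?le_max ?lexx ?orbT // lb_le_inf //.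
  by exists `|x - coord_proj e es A x|, A.
rewrite ler_wpM2l ?(le_trans ler01) // ge_inf //; first by exists 0.
by exists A.
Qed.

Hypothesis biorth : forall i j, es i (e j) = (i == j)%:R.
Context {C : R}.
Hypothesis C1 : 1 <= C.
Hypothesis ag : forall (x : X) (L A : {fset I}), greedy_set es #|` L| x L ->
    (#|` A| <= #|` L|)%N ->
    `|x - coord_proj e es L x| <= C * `|x - coord_proj e es A x|.

Lemma greedy_residual_le (x : X) (L : {fset I}) :
  greedy_set es #|` L| x L -> `|x - coord_proj e es L x| <= C * `|x|.
Proof.
move=> grL; have := @ag x L fset0 grL; rewrite cardfs0 => /(_ isT).
by rewrite /coord_proj big_seq_fset0 subr0.
Qed.

Lemma greedy_proj_le (x : X) (L : {fset I}) :
  greedy_set es #|` L| x L -> `|coord_proj e es L x| <= (1 + C) * `|x|.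
Proof.
move=> grL; rewrite -{1}(subKr x (coord_proj e es L x)).
rewrite (le_trans (ler_normB _ _)) // mulrDl mul1r lerD2l.
exact: greedy_residual_le.
Qed.

(** With coefficients of equal modulus, every subset of [G] is greedy for [u]. Writing
    [d = (1 + d / c) * c - c] gives weights in [[0, 2]], so Abel summation costs [2 * (1 + C)] and
    the subtracted [u] at most [1 + C]. *)
Lemma flat_sum_le {G : {fset I}} {t : R} {c d : I -> R} :
  (forall i, i \in G -> `|c i| = t) -> (forall i, i \in G -> `|d i| <= t) ->
  `|\sum_(i <- G) d i *: e i| <= 3 * (1 + C) * `|\sum_(i <- G) c i *: e i|.
Proof.
move=> ct dt; set u := \sum_(i <- G) c i *: e i.
have projT T : (T `<=` G)%fset -> `|\sum_(i <- T) c i *: e i| <= (1 + C) * `|u|.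
  move=> TG; rewrite -(coord_proj_sum biorth TG); apply: greedy_proj_le.
  split=> // i j iT jT; rewrite mul1r !(coord_sum biorth).
  have iG := fsubsetP TG _ iT; rewrite iG (ct i iG).
  by case: ifP => [/ct->//|_]; rewrite normr0 -(ct i iG).
have q i : i \in G -> -1 <= d i / c i <= 1.
  move=> iG; rewrite -ler_norml normrM normfV ct //.
  have [t0|t0] := eqVneq t 0; first by rewrite t0 invr0 mulr0.
  have tp : 0 < t by rewrite lt_def t0 -(ct i iG) normr_ge0.
  by rewrite ler_pdivrMr // mul1r dt.
have -> : \sum_(i <- G) d i *: e i =
    \sum_(i <- G) (1 + d i / c i) *: (c i *: e i) - u.
  rewrite -sumrB; apply: eq_fbigr => i iG _.
  rewrite scalerDl scale1r addrC addKr scalerA.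
  (* If [c i = 0], then [t = 0], so [d i = 0] as well. *)
  have [c0|c0] := eqVneq (c i) 0; last by rewrite divfK.
  have : `|d i| <= 0 by rewrite (le_trans (dt _ iG)) // -(ct _ iG) c0 normr0.
  by rewrite normr_le0 => /eqP ->; rewrite !mul0r.
have := @norm_weighted_sum_le _ _ _ G (fun i => c i *: e i)
  (fun i => 1 + d i / c i) 2 ((1 + C) * `|u|) ltac:(lra).
have un : `|u| <= (1 + C) * `|u| by rewrite ler_peMl // lerDl (le_trans ler01).
move=> h; rewrite (le_trans (ler_normB _ _)) //.
have -> : 3 * (1 + C) * `|u| = 2 * ((1 + C) * `|u|) + (1 + C) * `|u| by lra.
rewrite lerD // h // => [i iG|H HG _]; last exact: projT.
by have := q i iG; lra.
Qed.

(* [sg (e_i^*(x)) t = (1 - v_i) e_i^*(x)] with [v_i = 1 - t / |e_i^*(x)|], whose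
   upper sets are greedy sets of [x]. *)
Lemma truncation_le {x : X} {G : {fset I}} {t : R} : 0 < t ->
  (forall i, (i \in G) = (t <= `|es i x : R|)) ->
  `|\sum_(i <- G) (Num.sg (es i x : R) * t) *: e i| <= 2 * (1 + C) * `|x|.
Proof.
move=> t0 hG.
have xi0 i : i \in G -> 0 < `|es i x : R| by rewrite hG; apply: lt_le_trans.
have -> : \sum_(i <- G) (Num.sg (es i x : R) * t) *: e i = coord_proj e es G x -
    \sum_(i <- G) (1 - t / `|es i x : R|) *: ((es i x : R) *: e i).
  rewrite -sumrB; apply: eq_fbigr => i iG _.
  rewrite -[X in X - _]scale1r -scalerBl subKr scalerA; congr (_ *: _).
  rewrite {3}(numEsg (es i x : R)) mulrCA divfK // gt_eqF //.
  exact: xi0.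
rewrite (le_trans (ler_normB _ _)) //.
have -> : 2 * (1 + C) * `|x| = (1 + C) * `|x| + 1 * ((1 + C) * `|x|) by lra.
have gr H :
    (forall i j, i \in H -> j \notin H -> `|es j x : R| <= `|es i x : R|) ->
    `|coord_proj e es H x| <= (1 + C) * `|x|.
  by move=> h; apply: greedy_proj_le; split=> // i j iH jH; rewrite mul1r h.
rewrite lerD //.
  apply: gr => i j; rewrite !hG -ltNge => ti /ltW jt; exact: le_trans jt ti.
apply: norm_weighted_sum_le => [//|i iG|H HG Hup].
  rewrite subr_ge0 gerBl ler_pdivrMr ?xi0 // mul1r -hG iG.
  by rewrite divr_ge0 // ltW.
apply: gr => i j iH jH; have iG := fsubsetP HG _ iH.
have [jG|] := boolP (j \in G); last first.
  by rewrite hG -ltNge => /ltW jt; apply: le_trans jt _; rewrite -hG.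
have := Hup i j iH jG jH.
by rewrite lerD2l lerN2 ler_pM2l // lef_pV2 // posrE xi0.
Qed.

(** In the constant, [2 * (1 + C)] pays for replacing [x] by its truncation [u] on the set [G] of
    all large coordinates, [3 * (1 + C)] for the part of [F] in [G], and [C] for the part
    outside. *)
Lemma sum_le_of_large_coords (he : bounded_markushevich_basis e es) {x : X}
    {B F : {fset I}} {t : R} {c : I -> R} : 0 <= t ->
  (forall i, i \in B -> t <= `|es i x : R|) ->
  (forall i, i \in F -> `|c i| <= t) -> (#|` F| <= #|` B|)%N ->
  `|\sum_(i <- F) c i *: e i| <=
     (3 * (1 + C) + C) * (2 * (1 + C)) * `|x|.
Proof.
have C0 : 0 <= C by rewrite (le_trans ler01).
(* For [t = 0] all coefficients on [F] vanish; finiteness of [G] is available only for [t > 0]. *)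
move=> t0 hB hF FB; have [tp|] := ltP 0 t; last first.
  move=> tn; rewrite big1_fset ?normr0; first by rewrite !(mulr_ge0, addr_ge0).
  by move=> i iF _; have := le_trans (hF i iF) tn; rewrite normr_le0 => /eqP->;
    rewrite scale0r.
have [G hG] := finite_large_coords (x := x) he tp.
have BG : (B `<=` G)%fset by apply/fsubsetP => i iB; rewrite hG hB.
have FG := leq_trans FB (fsubset_leq_card BG).
pose s i : R := Num.sg (es i x : R) * t.
have st i : i \in G -> `|s i| = t.
  rewrite hG => ti; rewrite normrM normr_sg (gtr0_norm tp).
  by rewrite -normr_gt0 (lt_le_trans tp ti) mul1r.
have := truncation_le tp hG; rewrite -/s.
set u := \sum_(i <- G) _ => ule.
rewrite -mulrA; apply: le_trans (ler_wpM2l _ ule); last first.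
  by rewrite !(mulr_ge0, addr_ge0).
(* [F `&` G] is handled by [flat_sum_le]; on [F `\` G], almost greediness is
   applied to [u + w], for which [G] is greedy and [F `\` G] competes with it. *)
rewrite (big_fsetIDset F G) /= mulrDl (le_trans (ler_normD _ _)) // lerD //.
  have -> : \sum_(i <- (F `&` G)%fset) c i *: e i =
      \sum_(i <- G) (if i \in F then c i else 0) *: e i.
    rewrite (big_fsetIDset G F) /= [X in _ = _ + X]big1_fset ?addr0.
      rewrite fsetIC; apply: eq_fbigr => i; rewrite !inE => /andP[_ ->] //.
    by move=> i; rewrite !inE => /andP[/negPf-> _] _; rewrite scale0r.
  apply: flat_sum_le st _ => i _; case: ifP => [/hF//|_].
  by rewrite normr0.
set w := \sum_(i <- _) _.
have wE : u + w =
    \sum_(i <- (G `|` F)%fset) (if i \in G then s i else c i) *: e i.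
  rewrite (big_fsetIDset (G `|` F)%fset G) /=; congr (_ + _).
    apply: eq_fbig => [i|i iG]; first by rewrite !inE andbC; case: (i \in G).
    by rewrite iG.
  apply: eq_fbig => [i|i]; first by rewrite !inE; case: (i \in G).
  by rewrite !inE => /andP[/negPf->].
have uE : coord_proj e es G (u + w) = u.
  rewrite wE coord_proj_sum ?fsubsetUl //.
  by apply: eq_fbigr => i iG _; rewrite iG.
have wE' : coord_proj e es (F `\` G)%fset (u + w) = w.
  rewrite wE coord_proj_sum //; last first.
    by apply/fsubsetP => i; rewrite !inE => /andP[_ ->]; rewrite orbT.
  by apply: eq_fbigr => i; rewrite !inE => /andP[/negPf-> _].
have := @ag (u + w) G (F `\` G)%fset.
rewrite uE wE' addrK [u + w - u]addrC addKr.
apply; last by rewrite (leq_trans (fsubset_leq_card (fsubsetDl _ _))).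
split=> // i j iG jG; rewrite mul1r wE !(coord_sum biorth).
rewrite !inE iG (negPf jG) /= st //; case: ifP => [/hF//|_].
by rewrite normr0.
Qed.

(** [F] is cut into [n] blocks of at most [#|B|] indices each. *)
Lemma sum_le_of_large_coords_mul (he : bounded_markushevich_basis e es) (n : nat)
    {x : X} {B F : {fset I}} {t : R} {c : I -> R} : 0 <= t ->
  (forall i, i \in B -> t <= `|es i x : R|) ->
  (forall i, i \in F -> `|c i| <= t) -> (#|` F| <= n * #|` B|)%N ->
  `|\sum_(i <- F) c i *: e i| <=
     n%:R * ((3 * (1 + C) + C) * (2 * (1 + C)) * `|x|).
Proof.
move=> t0 hB; elim: n F => [|n IH] F hF FB.
  move: FB; rewrite mul0n leqn0 cardfs_eq0 => /eqP->.
  by rewrite big_seq_fset0 normr0 mul0r.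
have [T TF Tc] := @exists_fsubset_card _ F (minn #|` F| #|` B|) (geq_minl _ _).
rewrite (big_fsetIDset F T) /= mulrSr mulrDl mul1r addrC.
rewrite (le_trans (ler_normD _ _)) // lerD //.
  apply: IH => [i|]; first by rewrite !inE => /andP[_ /hF].
  by rewrite cardfsDS // Tc; move: FB; rewrite mulSn; lia.
rewrite (fsetIidPr TF); apply: (sum_le_of_large_coords he t0 hB).
  by move=> i /(fsubsetP TF) /hF.
by rewrite Tc geq_minr.
Qed.

End AlmostGreedy.

(** * Comparison for weak greedy sets *)

Theorem theorem4p5 (R : realType) (X : completeNormedModType R)
    (d : option nat) (e : index_type d -> X)
    (es : index_type d -> {linear X -> R^o})
    (he : bounded_markushevich_basis e es)
    (hag : almost_greedy e es)
    (tau lambda : R) (htau : 0 < tau < 1) (hlambda : 0 <= lambda < 1) :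
  exists C : R,
    forall (x : X) (m : nat) (L A : {fset index_type d})
           (a : index_type d -> R),
      (0 < m)%N ->
      weak_greedy_set es tau m x L ->
      #|` (A `&` L)%fset|%:R <= lambda * m%:R ->
      (#|` A| <= m)%N ->
      `|x - coord_proj e es L x| <= C * `|x - \sum_(i <- A) a i *: e i|.
Proof.
have [C C1 ag] := almost_greedy_const hag.
have [_ biorth _ _ _] := he.
have /andP[tau0 tau1] := htau; have /andP[_ lam1] := hlambda.
(* This gives [n * (1 - lambda) >= 2]; as [L] minus [A] has at least [(1 - lambda) * m] indices, [n]
   blocks of that size cover [2 * m] indices. *)
pose n := Num.bound (2 / (1 - lambda)).
pose K := n%:R * ((3 * (1 + C) + C) * (2 * (1 + C))) / tau.
exists (C + K + K) => x m L A a m0 [cardL wL] AL Am.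
set z := x - _.
have esz i : es i z = (es i x : R) - (if i \in A then a i else 0).
  by rewrite linearB /= (coord_sum biorth).
have [|i0 i0L i0min] := @exists_fset_min _ _ L (fun i => `|es i x : R|).
  by rewrite -cardfs_gt0 cardL.
set t := `|es i0 x : R| in i0min.
have t0 : 0 <= t by exact: normr_ge0.
pose B := (L `\` A)%fset.
have hB i : i \in B -> t <= `|es i z : R|.
  by rewrite inE => /andP[/negPf iA iL]; rewrite esz iA subr0 i0min.
have out i : i \notin L -> `|es i x : R| <= t / tau.
  by move=> iL; rewrite ler_pdivlMr // mulrC; exact: wL.
have cardB : (2 * m <= n * #|` B|)%N.
  have lam0 : 0 < 1 - lambda by rewrite subr_gt0.
  have BE : (1 - lambda) * m%:R <= #|` B|%:R.
    have mE := cardfsID A L; rewrite fsetIC cardL in mE.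
    by move: AL; rewrite -mE natrD; lra.
  have n2 : 2 <= n%:R * (1 - lambda).
    rewrite -ler_pdivrMr // ltW // /n.
    by apply: archi_boundP; rewrite divr_ge0 // ltW.
  rewrite -(ler_nat R) !natrM.
  have := ler_wpM2l (ler0n R n) BE; have := ler_wpM2r (ler0n R m) n2; lra.
(* Scaling by [tau] brings coefficients from height [t / tau] down to [t], whence the division by
   [tau] in [K]. *)
have key (F : {fset index_type d}) (c : index_type d -> R) :
    (forall i, i \in F -> `|c i| <= t / tau) -> (#|` F| <= 2 * m)%N ->
    `|\sum_(i <- F) c i *: e i| <= K * `|z|.
  move=> hF cF.
  have := @sum_le_of_large_coords_mul _ _ _ _ _ biorth _ C1 ag he n z B F t
    (fun i => tau * c i) t0 hB.
  have -> : \sum_(i <- F) (tau * c i) *: e i = tau *: \sum_(i <- F) c i *: e i.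
    by rewrite scaler_sumr; apply: eq_bigr => i _; rewrite scalerA.
  rewrite normrZ (gtr0_norm tau0) mulrC -ler_pdivlMr // => h.
  rewrite /K mulrAC -[_ * _ * `|z|]mulrA; apply: h => [i iF|].
    2: exact: leq_trans cF cardB.
  by rewrite normrM (gtr0_norm tau0) mulrC -ler_pdivlMr // hF.
pose G := [fset i in (A `|` L)%fset | t / tau < `|es i z : R|]%fset.
have small i : i \notin G -> `|es i z : R| <= t / tau.
  rewrite !inE negb_and => /orP[|]; last by rewrite -leNgt.
  rewrite negb_or => /andP[/negPf iA iL].
  by rewrite esz iA subr0 out.
have grG : greedy_set es #|` G| z G.
  split=> // i j iG /small jt; rewrite mul1r; apply: le_trans jt _.
  by move: iG; rewrite !inE => /andP[_ /ltW].
(* Since [x - z] is supported in [A], [x] and [z] have the same residual after projection on the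
   union of [A] and [L]; that projection is then split along [G] for [z] and along [L] for [x]. *)
have decomp : x - coord_proj e es L x = (z - coord_proj e es G z)
    - \sum_(i <- ((A `|` L) `\` G)%fset) (es i z : R) *: e i
    + \sum_(i <- (A `\` L)%fset) (es i x : R) *: e i.
  have GU : (G `<=` A `|` L)%fset.
    by apply/fsubsetP => i; rewrite !inE => /andP[].
  have splitG : coord_proj e es (A `|` L)%fset z = coord_proj e es G z
      + \sum_(i <- ((A `|` L) `\` G)%fset) (es i z : R) *: e i.
    by rewrite {1}/coord_proj (big_fsetIDset _ G) /= (fsetIidPr GU).
  have projx : coord_proj e es (A `|` L)%fset x = coord_proj e es L x
      + \sum_(i <- (A `\` L)%fset) (es i x : R) *: e i.
    by rewrite {1}/coord_proj (big_fsetIDset _ L) /=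
       (fsetIidPr (fsubsetUr A L)) fsetDUl fsetDv fsetU0.
  have projz : coord_proj e es (A `|` L)%fset z =
      coord_proj e es (A `|` L)%fset x - \sum_(i <- A) a i *: e i.
    rewrite -(coord_proj_sum biorth (fsubset_refl A)) /coord_proj.
    rewrite (big_fset_incl _ (fsubsetUl A L)) /=; last first.
      by move=> i _ iA; rewrite (coord_sum biorth) (negPf iA) scale0r.
    by rewrite -sumrB; apply: eq_bigr => i _; rewrite linearB scalerBl.
  rewrite -[z - _ - _]addrA -opprD -splitG projz projx /z.
  by rewrite opprB addrA subrK opprD addrA subrK.
rewrite decomp !mulrDl (le_trans (ler_normD _ _)) // lerD //.
  rewrite (le_trans (ler_normB _ _)) // lerD //.
    exact: (greedy_residual_le ag _ _ grG).
  apply: key => [i|]; first by rewrite inE => /andP[/small].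
  apply: leq_trans (fsubset_leq_card (fsubsetDl _ _)) _.
  by rewrite cardfsU cardL; lia.
apply: key => [i|]; first by rewrite inE => /andP[/out].
apply: leq_trans (fsubset_leq_card (fsubsetDl _ _)) _; lia.
Qed.
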